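(* For every $\varepsilon > 0$ there exists $\delta > 0$ such that the following holds for all sufficiently large integers $n$. Let $A$ and $B$ be sets of real numbers with $|A| = |B| = n$, and let $\mathcal{L}$ be a finite family of distinct lines in $\mathbb{R}^2$ such that (i) the lines in $\mathcal{L}$ have at least $n^{\varepsilon}$ distinct slopes, and (ii) every line of $\mathcal{L}$ is parallel to at least $n^{\varepsilon}$ other lines of $\mathcal{L}$. Then at least one line $\ell \in \mathcal{L}$ satisfies $|\ell \cap (A \times B)| < n^{1-\delta}$.
   Context: $A \times B = \{(a,b) : a \in A, b \in B\} \subset \mathbb{R}^2$ is the grid. Two lines are parallel if they have the same slope. *)

(* Defs.v *)
From HB Require Import structures.
From mathcomp Require Import all_boot all_order all_algebra.
From mathcomp Require Import reals exp.
Set Implicit Arguments. Unset Strict Implicit. Unset Printing Implicit Defensive.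
Import Order.TTheory GRing.Theory Num.Theory.
Local Open Scope ring_scope.

(* A line in R^2 in canonical form: (Some m, c) is the line y = m x + c,
   (None, c) is the vertical line x = c.  This is a bijection with the set
   of lines of R^2, so equality of representations = equality of lines. *)
Definition line (R : realType) : Type := (option R * R)%type.

Definition slope (R : realType) (l : line R) : option R := l.1.

Definition on_line (R : realType) (l : line R) (p : R * R) : bool :=
  match l.1 with
  | Some m => p.2 == m * p.1 + l.2
  | None => p.1 == l.2
  end.

(* The grid A x B, for A B given as duplicate-free sequences. *)
Definition grid (R : realType) (A B : seq R) : seq (R * R) :=
  [seq (a, b) | a <- A, b <- B].

Definition grid_incidences (R : realType) (l : line R) (A B : seq R) : nat :=
  count (on_line l) (grid A B).

Definition num_slopes (R : realType) (L : seq (line R)) : nat :=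
  size (undup (map (@slope R) L)).

Definition num_parallel_others (R : realType) (L : seq (line R)) (l : line R) : nat :=
  count (fun l' => (l' != l) && (slope l' == slope l)) L.

(* Main.v *)
(** Composing three lines of nonzero slope as [f3 o f2^-1 o f1] gives again a line,
    and by counting walks of length three in the incidence graph many of these
    compositions are rich if the lines are.  With the slopes [m1], [m3] of the outer
    lines fixed, the slope [m1 m3 / m2] takes many values, and for each [m2] the
    intercepts are the values of [(m3 / m2) c1 + c3] on a dense set of pairs
    [(c1, c3)].  By an incidence bound on the grid of these pairs, for most [m2]
    there are many more of these values than parallel lines before.  Starting from
    [n^eps] slopes and [n^eps] parallel lines and iterating O(1/eps) times, one
    obtains more rich parallel lines than the grid has room for. *)
Require Import Defs.
From HB Require Import structures.
From mathcomp Require Import all_boot all_order all_algebra.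
From mathcomp Require Import reals exp.
From mathcomp Require Import zify ring lra.
Import Order.TTheory GRing.Theory Num.Theory.
Local Open Scope ring_scope.

(** * Preliminaries and walks of length three in a bipartite graph *)

Lemma injective_nth {T : eqType} (x0 : T) (s : seq T) (m : nat) :
  uniq s -> (m <= size s)%N -> injective (fun i : 'I_m => nth x0 s i).
Proof.
move=> us ms i j /eqP.
rewrite nth_uniq //; first by move/eqP/val_inj.
- exact: leq_trans (ltn_ord i) ms.
- exact: leq_trans (ltn_ord j) ms.
Qed.

(* Edges at a vertex of degree below E / (4 n) carry at most half of the total
   weight E; on all the other edges both degrees are at least E / (4 n). *)
Lemma three_walks_lower_bound {X Y : finType} (n : nat) (M : X -> Y -> nat) :
  (#|X| <= n)%N -> (#|Y| <= n)%N ->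
  ((\sum_x \sum_y M x y) ^ 3 <=
   32 * n ^ 2 *
   \sum_x \sum_y (\sum_z M x z) * M x y * (\sum_z M z y))%N.
Proof.
move=> cX cY.
pose d x := (\sum_z M x z)%N; pose e y := (\sum_z M z y)%N.
set E := (\sum_x \sum_y M x y)%N.
(* Each side has at most [n] vertices, so its low-weight vertices carry at most [E / 4], and both
   sides together at most half of [E]. *)
have low (Z : finType) (f : Z -> nat) : (#|Z| <= n)%N ->
    (4 * \sum_(z | (4 * n * f z < E)%N) f z <= E)%N.
  move=> cZ; have [n0|n0] := posnP n.
    rewrite n0 in cZ *; rewrite big1 // => z; rewrite muln0 mul0n => E0.
    have Z0 : (0 < #|Z|)%N by apply/card_gt0P; exists z.
    by have := leq_trans Z0 cZ; lia.
  rewrite -(leq_pmul2l n0) mulnA (mulnC n) big_distrr /=.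
  apply: leq_trans (_ : \sum_(z : Z) E <= _)%N; last first.
    by rewrite sum_nat_const leq_mul2r cZ orbT.
  rewrite [leqRHS](bigID (fun z => 4 * n * f z < E)%N) /=.
  by apply: leq_trans (leq_addr _ _); apply: leq_sum => z /ltnW.
have lowX := low _ d cX; have lowY := low _ e cY.
have split_low : (E <= \sum_(x | (4 * n * d x < E)%N) d x
    + \sum_(y | (4 * n * e y < E)%N) e y
    + \sum_x \sum_y (if (E <= 4 * n * d x) && (E <= 4 * n * e y) then M x y
                     else 0))%N.
  rewrite big_mkcond [X in (_ + X + _)%N]big_mkcond /=.
  have -> : (\sum_y (if 4 * n * e y < E then e y else 0) =
     \sum_x \sum_y (if 4 * n * e y < E then M x y else 0))%N.
    rewrite exchange_big; apply: eq_bigr => y _.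
    by case: ifP => // _; rewrite big1.
  rewrite -!big_split; apply: leq_sum => x _ /=.
  have -> : ((if 4 * n * d x < E then d x else 0) =
     \sum_y (if 4 * n * d x < E then M x y else 0))%N.
    by case: ifP => // _; rewrite big1.
  rewrite -!big_split; apply: leq_sum => y _ /=.
  by rewrite !(leqNgt E); do 2!case: ifP => //= _; lia.
set H := (\sum_x \sum_y (if _ then _ else _))%N in split_low.
have EH : (E <= 2 * H)%N by lia.
have HW : (E ^ 2 * H <= 16 * n ^ 2 * \sum_x \sum_y d x * M x y * e y)%N.
  rewrite big_distrr [leqRHS]big_distrr /=; apply: leq_sum => x _.
  rewrite big_distrr [leqRHS]big_distrr /=; apply: leq_sum => y _.
  case: ifP => [/andP[dx ey]|_]; last by rewrite muln0.
  have := leq_mul (leq_mul dx ey) (leqnn (M x y)).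
  by rewrite -!mulnn; lia.
rewrite -[X in (_ <= _ * X)%N]/(\sum_x \sum_y d x * M x y * e y)%N.
have := leq_mul (leqnn (E ^ 2)) EH; rewrite -expnSr => /leq_trans -> //.
by move: HW; lia.
Qed.

(** * A weak incidence bound on a grid *)

(** Choose a representative in each fibre of [f] on [G]. Representatives inject into the image, and
    every other point collides with its representative. *)
Lemma card_le_image_plus_collisions {P : finType} {U : eqType} (f : P -> U)
    (G : {set P}) :
  (#|G| <= size (undup [seq f p | p <- enum G]) +
   #|[set pq : P * P | [&& pq.1 != pq.2 & f pq.1 == f pq.2]]|)%N.
Proof.
pose rep p := odflt p [pick q in G | f q == f p].
have frep p : f (rep p) = f p.
  by rewrite /rep; case: pickP => //= q /andP[_ /eqP].
have reP p q : p \in G -> q \in G -> f p = f q -> rep p = rep q.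
  move=> pG qG fpq; rewrite /rep.
  rewrite (@eq_pick _ _ (fun x => (x \in G) && (f x == f q))); last first.
    by move=> x; rewrite /= fpq.
  by case: pickP => //= /(_ q); rewrite qG eqxx.
rewrite -(cardsID [set p | rep p == p] G) leq_add //.
  rewrite cardE -(size_map f); apply: uniq_leq_size.
    rewrite map_inj_in_uniq ?enum_uniq // => p q.
    rewrite !mem_enum !inE => /andP[pG /eqP rp] /andP[qG /eqP rq] fpq.
    by rewrite -rp -rq; apply: reP.
  move=> u /mapP[p]; rewrite mem_enum !inE => /andP[pG _] ->.
  by rewrite mem_undup map_f // mem_enum.
rewrite -(@card_imset _ _ (fun p => (p, rep p))); last by move=> p q [].
apply/subset_leq_card/subsetP => _ /imsetP[p + ->].
by rewrite !inE /= frep eqxx andbT eq_sym => /andP[].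
Qed.

(** Cells are cut by rank instead of by value, so that for injective [b] a block of [h] ranks holds
    at most [h] indices however the values are spaced. *)
Lemma order_rank {R : realFieldType} {T : nat} (b : 'I_T -> R) :
  exists r : 'I_T -> 'I_T, forall t u, (r t <= r u)%N = (b t <= b u).
Proof.
pose below t := [set u | b u < b t].
have lt_below t : (#|below t| < T)%N.
  rewrite -[X in (_ < X)%N]card_ord -cardsT; apply: proper_card.
  rewrite properEneq subsetT andbT; apply/eqP => /setP/(_ t).
  by rewrite !inE ltxx.
exists (fun t => Ordinal (lt_below t)) => t u /=.
have [le_tu|lt_ut] := leP.
  apply: subset_leq_card; apply/subsetP => v; rewrite !inE.
  by move/lt_le_trans; apply.
apply/negbTE; rewrite -ltnNge; apply: proper_card; apply/properP; split.
  apply/subsetP => v; rewrite !inE => /lt_trans; exact.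
by exists u; rewrite !inE ?ltxx.
Qed.

(* The points of a line with nonzero slope are monotone in both coordinates, so
   a line meets few cells of a grid: the sum (or the difference) of the cell
   coordinates already determines the cell. *)
Lemma cell_of_key {R : realFieldType} {T : nat} (h N : nat) (b1 b3 : 'I_T -> R)
    (r1 r3 : 'I_T -> 'I_T) (mu : R) (p q : 'I_T * 'I_T) :
  (forall t u, (r1 t <= r1 u)%N = (b1 t <= b1 u)) ->
  (forall t u, (r3 t <= r3 u)%N = (b3 t <= b3 u)) ->
  (forall t, r3 t %/ h <= N)%N ->
  let key (s : 'I_T * 'I_T) :=
    (r1 s.1 %/ h + (if (0 < mu)%R then N - r3 s.2 %/ h else r3 s.2 %/ h))%N in
  mu * b1 p.1 + b3 p.2 = mu * b1 q.1 + b3 q.2 -> key p = key q ->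
  (r1 p.1 %/ h = r1 q.1 %/ h)%N /\ (r3 p.2 %/ h = r3 q.2 %/ h)%N.
Proof.
move=> mono1 mono3 bnd key.
have aux (s t : 'I_T * 'I_T) : b1 s.1 <= b1 t.1 ->
    mu * b1 s.1 + b3 s.2 = mu * b1 t.1 + b3 t.2 -> key s = key t ->
    (r1 s.1 %/ h = r1 t.1 %/ h)%N /\ (r3 s.2 %/ h = r3 t.2 %/ h)%N.
  move=> le1 eqv; rewrite /key.
  have := leq_div2r h (_ : r1 s.1 <= r1 t.1)%N; rewrite mono1 => /(_ le1).
  have := bnd s.2; have := bnd t.2.
  (* For [mu > 0] the second coordinate falls as the first grows. Reversing it makes both summands
     of the key nondecreasing, so equal keys force equal summands; [bnd] keeps the truncated
     subtraction exact. *)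
  case: ltP => mu0.
    have : b3 t.2 <= b3 s.2 by have := ler_wpM2l (ltW mu0) le1; lra.
    rewrite -mono3 => /(leq_div2r h).
    move: (r1 s.1 %/ h)%N (r1 t.1 %/ h)%N (r3 s.2 %/ h)%N (r3 t.2 %/ h)%N.
    by clear; lia.
  have : b3 s.2 <= b3 t.2 by have := ler_wnM2l mu0 le1; lra.
  rewrite -mono3 => /(leq_div2r h).
  move: (r1 s.1 %/ h)%N (r1 t.1 %/ h)%N (r3 s.2 %/ h)%N (r3 t.2 %/ h)%N.
  by clear; lia.
have [/aux//|/ltW le1 eqv eqk] := leP (b1 p.1) (b1 q.1).
by have [-> ->] := aux _ _ le1 (esym eqv) (esym eqk).
Qed.

(** Once the first point is known, the second is determined by the remainders of its two ranks
    modulo [h]. *)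
Lemma card_same_cell {T h : nat} (r1 r3 : 'I_T -> 'I_T) :
  injective r1 -> injective r3 -> (0 < h)%N ->
  (#|[set pq : ('I_T * 'I_T) * ('I_T * 'I_T) |
       (r1 pq.1.1 %/ h == r1 pq.2.1 %/ h) &&
       (r3 pq.1.2 %/ h == r3 pq.2.2 %/ h)]| <= T ^ 2 * h ^ 2)%N.
Proof.
move=> inj1 inj3 h0.
have lt_mod m : (m %% h < h)%N by rewrite ltn_mod.
pose f (pq : ('I_T * 'I_T) * ('I_T * 'I_T)) :=
  (pq.1, (Ordinal (lt_mod (r1 pq.2.1)), Ordinal (lt_mod (r3 pq.2.2)))).
rewrite -(@card_in_imset _ _ f); last first.
  move=> [[p1 p2] [p3 p4]] [[q1 q2] [q3 q4]]; rewrite !inE /f /=.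
  move=> /andP[/eqP e1 /eqP e2] /andP[/eqP e3 /eqP e4] [ep1 ep2 e5 e6].
  rewrite ep1 ep2 in e1 e2 *.
  have -> : p3 = q3.
    by apply/inj1/val_inj; rewrite /= (divn_eq (r1 p3) h) -e1 e3 e5 -divn_eq.
  have -> // : p4 = q4.
  by apply/inj3/val_inj; rewrite /= (divn_eq (r3 p4) h) -e2 e4 e6 -divn_eq.
by apply: leq_trans (max_card _) _; rewrite !card_prod !card_ord -!mulnn.
Qed.

(* A weak incidence bound of Szemeredi-Trotter type: two distinct points of one
   cell lie on a common line for at most one slope. *)
Lemma sum_card_le_line_images {R : realFieldType} {S T : nat} (h : nat)
    (b1 b3 : 'I_T -> R) (mu : 'I_S -> R) (D : {pred 'I_S})
    (G : 'I_S -> {set 'I_T * 'I_T}) :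
  injective b1 -> injective b3 -> injective mu -> (0 < h)%N ->
  (\sum_(i in D) #|G i| <=
   \sum_(i in D) size (undup [seq (mu i * b1 p.1 + b3 p.2)%R | p <- enum (G i)])
     * (2 * (T %/ h).+1) + T ^ 2 * h ^ 2)%N.
Proof.
move=> inj1 inj3 injmu h0.
have [r1 mono1] := order_rank b1; have [r3 mono3] := order_rank b3.
have injr1 : injective r1.
  by move=> t u e; apply/inj1/le_anti; rewrite -!mono1 e leqnn.
have injr3 : injective r3.
  by move=> t u e; apply/inj3/le_anti; rewrite -!mono3 e leqnn.
set N := (T %/ h)%N.
have bnd (r : 'I_T -> 'I_T) t : (r t %/ h <= N)%N.
  by apply: leq_div2r; apply: ltnW.
pose key i (s : 'I_T * 'I_T) :=
  (r1 s.1 %/ h + (if (0 < mu i)%R then N - r3 s.2 %/ h else r3 s.2 %/ h))%N.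
pose v i (p : 'I_T * 'I_T) := mu i * b1 p.1 + b3 p.2.
pose f i p := (v i p, key i p).
pose C i := [set pq : ('I_T * 'I_T) * ('I_T * 'I_T) |
  (pq.1 != pq.2) && (f i pq.1 == f i pq.2)].
(* A key is at most [2 * N], so attaching keys multiplies the number of values by at most
   [2 * N.+1]. The remaining points are paid for by collisions. *)
apply: leq_trans (_ : _ <= \sum_(i in D)
  (size (undup [seq v i p | p <- enum (G i)]) * (2 * N.+1) + #|C i|))%N _.
  apply: leq_sum => i _.
  apply: leq_trans (card_le_image_plus_collisions (f i) (G i)) _.
  rewrite leq_add2r -(size_iota 0 (2 * N.+1)) -[leqRHS](size_allpairs pair).
  apply: uniq_leq_size (undup_uniq _) _ => fp.
  rewrite mem_undup => /mapP[p pG ->]; apply: allpairs_f.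
    by rewrite mem_undup map_f.
  rewrite mem_iota /key add0n; have := bnd r1 p.1; have := bnd r3 p.2.
  move: (r3 p.2 %/ h)%N (r1 p.1 %/ h)%N => u w uN wN.
  by clear -uN wN; clearbody N; case: ifP => _; lia.
rewrite big_split leq_add2l.
apply: leq_trans _ (card_same_cell _ _ injr1 injr3 h0).
rewrite -[leqRHS]sum1_card [leqRHS]big_mkcond /=.
under eq_bigr => i _ do rewrite -sum1_card big_mkcond /=.
apply: (@leq_trans (\sum_i \sum_pq (if pq \in C i then 1 else 0)))%N.
  by rewrite [leqRHS](bigID (mem D)) /= leq_addr.
(* Each pair of points collides for at most one [i], and only if both points share a cell. *)
rewrite exchange_big /=; apply: leq_sum => [[p q]] _.
have [/forallP no_i|/forallPn /= [i]] := boolP [forall i, (p, q) \notin C i].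
  by rewrite big1 // => i _; rewrite (negbTE (no_i i)).
rewrite negbK => Ci; rewrite (bigD1 i) //= Ci big1 => [|j ji].
  move: Ci; rewrite !inE /= => /andP[_ /eqP[ev ek]].
  have [-> ->] := cell_of_key _ _ _ _ _ _ _ _ _ mono1 mono3 (bnd r3) ev ek.
  by rewrite !eqxx.
case: ifP => // Cj; case/negP: ji; apply/eqP/injmu.
move: Ci Cj; rewrite !inE /= => /andP[pq /eqP[evi _]] /andP[_ /eqP[evj _]].
have [eb|nb] := eqVneq (b1 p.1) (b1 q.1).
  case/negP: pq; move: evi; rewrite /v eb => /addrI/inj3 e2.
  by rewrite -pair_eqE /= (inj1 _ _ eb) e2 !eqxx.
apply/eqP; rewrite -subr_eq0.
have : (mu j - mu i) * (b1 p.1 - b1 q.1) = 0.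
  by move: evi evj; rewrite /v => ? ?; lra.
by move/eqP; rewrite mulf_eq0 (subr_eq0 (b1 p.1)) (negbTE nb) orbF.
Qed.

(** * Compositions of three rich lines *)

Lemma sum_bool_le1 {T : finType} (P : pred T) :
  (forall s t, P s -> P t -> s = t) -> (\sum_t (P t : nat) <= 1)%N.
Proof.
move=> uniqP; rewrite -[X in (X <= _)%N]/(\sum_t (if P t then 1 else 0))%N.
rewrite -big_mkcond sum1_card; apply/card_le1_eqP => s t Ps Pt; exact: uniqP.
Qed.

Lemma sum_triple {F X Y : finType} (D : F -> X -> nat) (M : F -> X -> Y -> nat)
    (E : F -> Y -> nat) :
  (\sum_x \sum_y (\sum_f D f x) * (\sum_f M f x y) * (\sum_f E f y) =
   \sum_(t : F * F * F) \sum_x \sum_y D t.2 x * M t.1.2 x y * E t.1.1 y)%N.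
Proof.
rewrite [RHS]exchange_big; apply: eq_bigr => x _ /=.
rewrite [RHS]exchange_big; apply: eq_bigr => y _ /=.
rewrite -(pair_bigA _ (fun p f => D f x * M p.2 x y * E p.1 y)%N) /=.
rewrite -(pair_bigA _ (fun f1 f2 => \sum_f D f x * M f2 x y * E f1 y)%N) /=.
rewrite big_distrr; apply: eq_bigr => f1 _ /=.
rewrite big_distrr big_distrl; apply: eq_bigr => f2 _ /=.
by rewrite !big_distrl.
Qed.

Definition incidences {R : realFieldType} {n : nat} (a b : 'I_n -> R)
  (m c : R) : nat := (\sum_x \sum_y (b y == (m * a x + c)%R))%N.

Lemma incidences_le {R : realFieldType} {n : nat} (a b : 'I_n -> R) (m c : R) :
  injective b -> (incidences a b m c <= n)%N.
Proof.
move=> injb; rewrite -[leqRHS]card_ord -sum1_card; apply: leq_sum => x _.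
by apply: sum_bool_le1 => y y' /eqP <- /eqP /injb.
Qed.

(* The slope and the intercept on the right are those of f3 o f2^-1 o f1. *)
Lemma walks_le_incidences {R : realFieldType} {n : nat} (a b : 'I_n -> R)
    (m1 m2 m3 c1 c2 c3 : R) :
  injective a -> injective b -> m2 != 0 ->
  (\sum_x \sum_y (\sum_z (b z == (m3 * a x + c3)%R)) * (b y == (m2 * a x + c2)%R)
      * (\sum_w (b y == (m1 * a w + c1)%R)) <=
   incidences a b (m1 * m3 / m2) (m3 / m2 * (c1 - c2) + c3))%N.
Proof.
move=> inja injb m20.
under eq_bigr => x _.
  under eq_bigr => y _.
    rewrite big_distrl big_distrr /=.
    under eq_bigr => w _ do rewrite big_distrl /=.
    over.
  rewrite exchange_big /=.
  under eq_bigr => w _ do rewrite exchange_big /=.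
  over.
rewrite exchange_big /=; apply: leq_sum => w _.
rewrite exchange_big /=; apply: leq_sum => z _.
(* With the endpoints [w] and [z] fixed, [w] determines [y] through the first line and [y]
   determines [x] through the second. So there is at most one walk, and none unless the composed
   line joins the endpoints. *)
rewrite pair_bigA /=; case: eqP => [_|neq].
  apply: leq_trans (sum_bool_le1 (fun p : 'I_n * 'I_n => [&& b z == m3 * a p.1 + c3,
     b p.2 == m2 * a p.1 + c2 & b p.2 == m1 * a w + c1]) _).
    by apply: leq_sum => p _; do 3!case: eqP.
  move=> [x y] [x' y'] /= /and3P[_ /eqP ex /eqP ey] /and3P[_ /eqP ex' /eqP ey'].
  have yy' : y = y' by apply: injb; rewrite ey ey'.
  congr (_, _) => //; apply: inja; apply: (mulfI m20); apply: (addIr c2).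
  by rewrite -ex -ex' yy'.
rewrite big1 // => -[x y] _ /=; case: eqP => // ez; case: eqP => // ex.
case: eqP => // ey; case: neq; rewrite ez.
have -> : a x = (m1 * a w + c1 - c2) / m2.
  by rewrite -ey ex addrK mulrC mulKf.
by field.
Qed.

(** There are at least [#|F| ^ 3 * n / (32 * K ^ 3)] walks. Triples below the richness threshold
    account for at most half of this number, and any other triple for at most [n] walks. *)
Lemma many_rich_triples {R : realFieldType} {F : finType} {n : nat} (K : nat)
    (a b : 'I_n -> R) (m c : F -> R) :
  injective a -> injective b -> (0 < n)%N -> (forall f, m f != 0) ->
  (forall f, n <= K * incidences a b (m f) (c f))%N ->
  (#|F| ^ 3 <= 64 * K ^ 3 * #|[set t : F * F * F |
     n <= 64 * K ^ 3 *
       incidences a b (m t.1.1 * m t.2 / m t.1.2)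
         (m t.2 / m t.1.2 * (c t.1.1 - c t.1.2) + c t.2)]|)%N.
Proof.
move=> inja injb n0 m0 rich.
pose g (t : F * F * F) := incidences a b (m t.1.1 * m t.2 / m t.1.2)
         (m t.2 / m t.1.2 * (c t.1.1 - c t.1.2) + c t.2).
pose W := (\sum_t g t)%N.
pose M x y := (\sum_f (b y == (m f * a x + c f)%R))%N.
set E := (\sum_x \sum_y M x y)%N.
have EK : (#|F| * n <= K * E)%N.
  have -> : E = (\sum_f incidences a b (m f) (c f))%N.
    rewrite /E /M /incidences; under eq_bigr => x _ do rewrite exchange_big.
    by rewrite exchange_big.
  by rewrite -sum_nat_const big_distrr; apply: leq_sum.
have EW : (E ^ 3 <= 32 * n ^ 2 * W)%N.
  have cn : (#|'I_n| <= n)%N by rewrite card_ord.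
  apply: leq_trans (three_walks_lower_bound n M cn cn) _.
  rewrite leq_mul2l; apply/orP; right.
  under eq_bigr => x _ do under eq_bigr => y _ do
    rewrite [X in (X * _ * _)%N]exchange_big [X in (_ * X)%N]exchange_big /=.
  rewrite (sum_triple (fun f x => \sum_z (b z == (m f * a x + c f)%R))%N
    (fun f x y => (b y == (m f * a x + c f)%R) : nat)
    (fun f y => \sum_w (b y == (m f * a w + c f)%R))%N).
  by apply: leq_sum => t _; apply: walks_le_incidences.
have FW : (#|F| ^ 3 * n <= 32 * K ^ 3 * W)%N.
  have : ((#|F| * n) ^ 3 <= (K * E) ^ 3)%N by rewrite leq_exp2r.
  rewrite !expnMn => /leq_trans /(_ (leq_mul (leqnn (K ^ 3)) EW)) H.
  have n2 : (0 < n ^ 2)%N by rewrite expn_gt0 n0.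
  rewrite -(leq_pmul2r n2); apply: leq_trans (leq_trans _ H) _.
    by rewrite -mulnA -expnS.
  by clear; lia.
set G := [set t | _]; set L := (64 * K ^ 3)%N.
have WG : (L * W <= L * (#|G| * n) + #|F| ^ 3 * n)%N.
  rewrite /W (bigID (mem G)) /= mulnDr; apply: leq_add.
    rewrite leq_mul2l -sum_nat_const; apply/orP; right.
    by apply: leq_sum => t _; apply: incidences_le.
  have -> : (#|F| ^ 3 = #|{: F * F * F}|)%N by rewrite !card_prod !expnS; lia.
  rewrite -sum_nat_const big_distrr [leqRHS](bigID (mem G)) /=.
  apply: leq_trans (leq_addl _ _); apply: leq_sum => t.
  by rewrite inE -ltnNge => /ltnW.
by rewrite -(leq_pmul2r n0) -/L; move: WG FW; rewrite /L; lia.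
Qed.

(** * Pigeonhole arguments and the amplification step *)

Lemma card_fibers {X Y : finType} (A : {set X}) (f : X -> Y) :
  (#|A| = \sum_y #|[set x in A | f x == y]|)%N.
Proof.
rewrite -sum1_card (partition_big f predT) //=; apply: eq_bigr => y _.
by rewrite -sum1_card; apply: eq_bigl => x; rewrite inE.
Qed.

Lemma exists_ge_average {X : finType} (f : X -> nat) (v : nat) :
  (0 < #|X|)%N -> (#|X| * v <= \sum_x f x)%N -> exists x, (v <= f x)%N.
Proof.
move=> X0 ave; apply/existsP; apply: contraLR ave => /existsPn small.
case/card_gt0P: X0 => x0 _.
rewrite -ltnNge -sum_nat_const (bigD1 x0) //= [ltnRHS](bigD1 x0) //=.
rewrite -addSn leq_add // ?ltnNge //.
by apply: leq_sum => x _; apply: ltnW; rewrite ltnNge.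
Qed.

Lemma card_le_max_fiber {X : finType} {T : nat} (A : {set X})
    (f : X -> 'I_T) (t0 : 'I_T) :
  exists t, (#|A| <= T * #|[set x in A | f x == t]|)%N.
Proof.
have [] := @exists_ge_average 'I_T (fun t => T * #|[set x in A | f x == t]|)%N #|A|.
- by apply/card_gt0P; exists t0.
- by rewrite card_ord -big_distrr -card_fibers.
by move=> t At; exists t.
Qed.

(** Nonzero slopes make the lines invertible. The integer [K] records the loss of richness, which
    keeps real exponents out of the iteration. *)
Definition rich_family {R : realFieldType} {n : nat} (a b : 'I_n -> R)
    (S T K : nat) :=
  exists (m : 'I_S -> R) (c : 'I_S -> 'I_T -> R),
    [/\ injective m, forall i, m i != 0, forall i, injective (c i) &
        forall i t, (n <= K * incidences a b (m i) (c i t))%N].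

(* Fix the slopes of f1, f3 and, for each slope of f2, its best intercept. *)
Lemma popular_outer_slopes {S T : nat} (K : nat)
    (A : {set ('I_S * 'I_T) * ('I_S * 'I_T) * ('I_S * 'I_T)}) :
  (0 < S)%N -> (0 < T)%N -> ((S * T) ^ 3 <= K * #|A|)%N ->
  exists (i1 i3 : 'I_S) (t2 : 'I_S -> 'I_T),
    (S * T ^ 2 <= K * \sum_i #|[set p : 'I_T * 'I_T |
        ((i1, p.1), (i, t2 i), (i3, p.2)) \in A]|)%N.
Proof.
move=> S0 T0 AK.
pose Aq q := [set t in A | (t.1.1.1, t.2.1) == q].
have [||[i1 i3] Aqbig] := @exists_ge_average ('I_S * 'I_S)%type
  (fun q => K * #|Aq q|)%N (S * T ^ 3)%N.
- by rewrite card_prod card_ord muln_gt0 S0.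
- rewrite -big_distrr -card_fibers card_prod card_ord.
  by apply: leq_trans AK; clear; lia.
have best i := card_le_max_fiber [set t in Aq (i1, i3) | t.1.2.1 == i]
  (fun t => t.1.2.2) (Ordinal T0).
have {best} [t2 best] : exists t2 : 'I_S -> 'I_T, forall i,
    (#|[set t in Aq (i1, i3) | t.1.2.1 == i]| <=
     T * #|[set t in [set t in Aq (i1, i3) | t.1.2.1 == i] | t.1.2.2 == t2 i]|)%N.
  by exists (fun i => xchoose (best i)) => i; apply: (xchooseP (best i)).
exists i1, i3, t2.
have := Aqbig; rewrite (card_fibers _ (fun t => t.1.2.1)) => le1.
rewrite -(leq_pmul2r T0) -mulnA -expnSr; apply: leq_trans le1 _.
rewrite -mulnA leq_mul2l big_distrl; apply/orP; right; apply: leq_sum => i _ /=.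
apply: leq_trans (best i) _; rewrite mulnC leq_mul2r.
apply/orP; right.
(* With all three slopes and the middle intercept fixed, a triple is determined by its outer
   intercepts. *)
rewrite -(@card_in_imset _ _ (fun t => (t.1.1.2, t.2.2))).
  apply/subset_leq_card/subsetP => _ /imsetP[[[[x1 t1] [x2 y2]] [x3 t3]] + ->].
  by rewrite !inE /= => /andP[/andP[/andP[tA /eqP[<- <-]] /eqP <-] /eqP <-].
move=> [[[x1 t1] [x2 y2]] [x3 t3]] [[[x1' t1'] [x2' y2']] [x3' t3']].
rewrite !inE /= => /andP[/andP[/andP[_ /eqP[-> ->]] /eqP ->] /eqP ->].
by move=> /andP[/andP[/andP[_ /eqP[-> ->]] /eqP ->] /eqP ->] [-> ->].
Qed.

(** The total size of the sets [G i] splits into the values for slopes in [few], the collisions, and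
    the other slopes. Multiplied by [L], each of the first two is at most a third of [S * T ^ 2], so
    at least [S / (3 * L)] slopes have [T'] or more intercepts. *)
Lemma rich_family_step {R : realFieldType} {n : nat} (a b : 'I_n -> R)
    (S T K h S' T' : nat) :
  injective a -> injective b -> (0 < n)%N -> (0 < K)%N -> (0 < h <= T)%N ->
  (3 * (64 * K ^ 3) * h ^ 2 <= S)%N -> (3 * (64 * K ^ 3) * S' <= S)%N ->
  (12 * (64 * K ^ 3) * T' <= T * h)%N ->
  rich_family a b S T K -> rich_family a b S' T' (64 * K ^ 3).
Proof.
move=> inja injb n0 K0 /andP[h0 hT] hS hS' hT' [m [c [injm m0 injc rich]]].
have := @many_rich_triples R ('I_S * 'I_T)%type n K a b (fun f => m f.1)
  (fun f => c f.1 f.2) inja injb n0 (fun f => m0 f.1) (fun f => rich f.1 f.2).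
set L := (64 * K ^ 3)%N in hS hS' hT' *.
have L0 : (0 < L)%N by rewrite muln_gt0 expn_gt0 K0.
clearbody L.
have T0 : (0 < T)%N by apply: leq_trans hT.
have S0 : (0 < S)%N.
  by apply: leq_trans hS; rewrite !muln_gt0 L0 h0.
rewrite card_prod !card_ord => /(popular_outer_slopes _ _ S0 T0)[i1 [i3 [t2]]].
move=> GL0.
pose G i := [set p : 'I_T * 'I_T | n <= L * incidences a b
  (m i1 * m i3 / m i) (m i3 / m i * (c i1 p.1 - c i (t2 i)) + c i3 p.2)]%N.
have {GL0} : (S * T ^ 2 <= L * \sum_i #|G i|)%N.
  apply: leq_trans GL0 _; rewrite leq_mul2l; apply/orP; right.
  apply: leq_sum => i _; apply/subset_leq_card/subsetP => p.
  by rewrite !inE.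
pose mu i := m i3 / m i.
have injmu : injective mu by move=> i j /(mulfI (m0 i3)) /invr_inj /injm.
(* The shift by [mu i * c i (t2 i)] is constant for fixed [i], so it does not affect the count; it
   is restored in the final witness. *)
pose im i := undup [seq mu i * c i1 p.1 + c i3 p.2 | p <- enum (G i)].
pose few := [pred i | (size (im i) < T')%N].
have GT i : (#|G i| <= T ^ 2)%N.
  by apply: leq_trans (max_card _) _; rewrite card_prod card_ord mulnn.
have fewB := @sum_card_le_line_images R S T h (c i1) (c i3) mu few G
  (injc _) (injc _) injmu h0.
set u := (T %/ h).+1 in fewB.
have hu : (u * h <= 2 * T)%N.
  by rewrite mulSn; have := leq_trunc_div T h; lia.
have imB : (\sum_(i in few) size (im i) * (2 * u) <= S * T' * (2 * u))%N.
  rewrite -big_distrl; apply: leq_mul => //=.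
  apply: leq_trans (_ : \sum_(i in few) T' <= _)%N.
    by apply: leq_sum => i /ltnW.
  rewrite sum_nat_const leq_mul2r -[X in (_ <= X)%N]card_ord.
  by rewrite max_card orbT.
have manyB : (\sum_(i | i \notin few) #|G i| <= #|[predC few]| * T ^ 2)%N.
  by rewrite -sum_nat_const; apply: leq_sum => i _.
rewrite (bigID (mem few)) /= => GL.
(* The 12 is 3 for the third, 2 from the number of keys, and 2 from [u * h <= 2 * T]. *)
have uT : (3 * L * (S * T' * (2 * u)) <= S * T ^ 2)%N.
  rewrite -(leq_pmul2r h0).
  apply: leq_trans (_ : 6 * L * S * T' * (2 * T) <= _)%N.
    have := leq_mul (leqnn (6 * L * S * T')) hu; lia.
  have := leq_mul (leqnn (S * T)) hT'; lia.
have manyS : (S <= 3 * L * #|[predC few]|)%N.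
  have T2 : (0 < T ^ 2)%N by rewrite expn_gt0 T0.
  rewrite -(leq_pmul2r T2).
  have hST := leq_mul hS (leqnn (T ^ 2)).
  have := leq_trans GL (leq_mul (leqnn L) (leq_add
    (leq_trans fewB (leq_add imB (leqnn _))) manyB)).
  by move: uT hST; clear; lia.
have S'many : (S' <= size (enum [predC few]))%N.
  rewrite -cardE -(@leq_pmul2l (3 * L)) ?muln_gt0 ?L0 //.
  exact: leq_trans hS' manyS.
pose phi (j : 'I_S') := nth (Ordinal S0) (enum [predC few]) j.
have injphi : injective phi by apply: injective_nth => //; apply: enum_uniq.
have T'im j : (T' <= size (im (phi j)))%N.
  have : phi j \in enum [predC few].
    by apply: mem_nth; apply: leq_trans S'many.
  by rewrite mem_enum inE /= -leqNgt.
exists (fun j => m i1 * m i3 / m (phi j)).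
exists (fun j t => nth 0 (im (phi j)) t - mu (phi j) * c (phi j) (t2 (phi j))).
split.
- move=> i j; rewrite -!(mulrA (m i1)) => /(mulfI (m0 i1)) /injmu.
  exact: injphi.
- by move=> j; rewrite !mulf_neq0 ?invr_neq0.
- move=> j s t /addIr; exact: (injective_nth 0 _ _ (undup_uniq _) (T'im j)).
move=> j t.
have : nth 0 (im (phi j)) t \in im (phi j).
  by apply: mem_nth; apply: leq_trans (T'im j).
rewrite mem_undup => /mapP[p]; rewrite mem_enum !inE /= => pG ->.
apply: leq_trans pG _; rewrite leq_mul2l; apply/orP; right.
by rewrite eq_leq //; congr incidences; rewrite mulrBr -/(mu _); ring.
Qed.

(** * Iteration until the grid has no room left *)

(** Parallel lines are disjoint, so those of one slope share at most [n ^ 2] grid points, while each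
    takes at least [n / K]. *)
Lemma rich_family_size {R : realFieldType} {n : nat} (a b : 'I_n -> R)
    (S T K : nat) :
  injective b -> (0 < n)%N -> (0 < S)%N -> rich_family a b S T K ->
  (T <= K * n)%N.
Proof.
move=> injb n0 S0 [m [c [_ _ injc rich]]]; pose i := Ordinal S0.
rewrite -(leq_pmul2r n0).
have -> : (T * n = \sum_(t < T) n)%N by rewrite sum_nat_const card_ord.
apply: (@leq_trans (\sum_(t < T) K * incidences a b (m i) (c i t))).
  by apply: leq_sum => t _; apply: rich.
rewrite -big_distrr -mulnA leq_mul2l /incidences exchange_big /=.
apply/orP; right.
have -> : (n * n = \sum_(x < n) \sum_(y < n) 1)%N.
  by rewrite !sum_nat_const !card_ord muln1.
apply: leq_sum => x _; rewrite exchange_big /=; apply: leq_sum => y _.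
by apply: sum_bool_le1 => s t /eqP -> /eqP /addrI /injc.
Qed.

Lemma rich_family_leK {R : realFieldType} {n : nat} (a b : 'I_n -> R)
    (S T K K' : nat) :
  (K <= K')%N -> rich_family a b S T K -> rich_family a b S T K'.
Proof.
move=> leK [m [c [injm m0 injc rich]]]; exists m, c; split=> // i t.
by apply: leq_trans (rich i t) _; rewrite leq_mul2r leK orbT.
Qed.

(* Each step costs a factor Q ^ (C + 1) in the number of slopes, while the number
   of parallel lines grows by a factor Q ^ (g - (C + 1)). *)
Lemma rich_family_iterate {R : realFieldType} {n : nat} (a b : 'I_n -> R)
    (Q W : nat) :
  let C := (4 ^ W)%N in let g := (2 * W.+1 * C.+1)%N in
  injective a -> injective b -> (0 < n)%N -> (64 <= Q)%N ->
  rich_family a b (Q ^ (3 * g)) (Q ^ (3 * g)) Q ->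
  forall j, (j <= W)%N ->
  rich_family a b (Q ^ (3 * g - j * C.+1)) (Q ^ (3 * g + j * (g - C.+1)))
    (Q ^ (4 ^ j)).
Proof.
move=> C g inja injb n0 Q64 rich0; elim=> [_|j IHj jW].
  by rewrite !mul0n subn0 addn0 expn0 expn1.
have Q0 : (0 < Q)%N by apply: leq_trans Q64.
have Qle x y : (x <= y)%N -> (Q ^ x <= Q ^ y)%N by exact: leq_pexp2l.
have L1 : (64 * (Q ^ (4 ^ j)) ^ 3 <= Q ^ (4 ^ j.+1))%N.
  rewrite -expnM; apply: leq_trans (leq_mul Q64 (leqnn _)) _.
  rewrite -expnS; apply: Qle; rewrite expnS; have : (0 < 4 ^ j)%N by rewrite expn_gt0.
  by lia.
have LC : (64 * (Q ^ (4 ^ j)) ^ 3 <= Q ^ C)%N.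
  by apply: leq_trans L1 _; apply: Qle; apply: leq_pexp2l.
(* The numerical constants of the step are absorbed into one extra factor [Q]. *)
have smallL k : (k <= 64)%N -> (k * (64 * (Q ^ (4 ^ j)) ^ 3) <= Q ^ C.+1)%N.
  by move=> k64; rewrite [leqRHS]expnS; apply: (leq_mul _ LC); apply: leq_trans Q64.
have jg : (j.+1 * C.+1 <= g)%N by rewrite /g leq_mul2r; lia.
have Cg : (C.+1 <= g)%N by apply: leq_trans jg; rewrite leq_pmull.
apply: rich_family_leK L1 _.
(* The block size is always [h = Q ^ g]. By [jg] at most [g] of the exponent [3 * g] is ever spent,
   so room for [h ^ 2] remains. *)
apply: (rich_family_step a b _ _ _ (Q ^ g) _ _ _ _ _ _ _ _ _ _ (IHj (ltnW jW))).
- by [].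
- by [].
- by [].
- by rewrite expn_gt0 Q0.
- by rewrite expn_gt0 Q0 Qle //; lia.
- apply: leq_trans (leq_mul (smallL 3 isT) (leqnn _)) _.
  rewrite -expnM -expnD; apply: Qle; move: jg; rewrite mulSn.
  by clearbody g; lia.
- apply: leq_trans (leq_mul (smallL 3 isT) (leqnn _)) _.
  rewrite -expnD; apply: Qle; move: jg; rewrite mulSn.
  by clearbody g; lia.
- apply: leq_trans (leq_mul (smallL 12 isT) (leqnn _)) _.
  rewrite -!expnD; apply: Qle; rewrite mulSn.
  by move: Cg; clearbody g; lia.
Qed.

(** Since [g - C.+1 = (2 * W).+1 * C.+1], after [W] steps the number of parallel lines exceeds
    [Q ^ C * n], the most that [rich_family_size] allows. *)
Lemma no_rich_family {R : realFieldType} {n : nat} (a b : 'I_n -> R)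
    (Q W : nat) :
  let C := (4 ^ W)%N in let g := (2 * W.+1 * C.+1)%N in
  injective a -> injective b -> (0 < n)%N -> (64 <= Q)%N ->
  (n < Q ^ (W * W.+1 * C.+1))%N ->
  ~ rich_family a b (Q ^ (3 * g)) (Q ^ (3 * g)) Q.
Proof.
move=> C g inja injb n0 Q64 nQ rich0.
have Q0 : (0 < Q)%N by apply: leq_trans Q64.
have := rich_family_iterate _ _ _ _ inja injb n0 Q64 rich0 W (leqnn W).
move/(rich_family_size _ _ _ _ _ injb n0); rewrite expn_gt0 Q0 => /(_ isT).
apply/negP; rewrite -ltnNge.
apply: leq_trans (_ : Q ^ C * Q ^ (W * W.+1 * C.+1) <= _)%N.
  by rewrite ltn_pmul2l // expn_gt0 Q0.
rewrite -expnD; apply: leq_pexp2l => //; rewrite -/C -/g.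
have -> : (g - C.+1 = (2 * W).+1 * C.+1)%N.
  by rewrite /g -[X in (_ - X)%N]mul1n -mulnBl; congr muln; lia.
have : (C.+1 <= g)%N by rewrite /g leq_pmull.
by clearbody g C; nia.
Qed.

(** * Passage from the given lines to a rich family, and choice of parameters *)

Lemma grid_incidencesE {R : realType} {n : nat} (A B : seq R) (m c : R) :
  size A = n -> size B = n ->
  grid_incidences (Some m, c) A B =
  incidences (fun i : 'I_n => nth 0 A i) (fun i : 'I_n => nth 0 B i) m c.
Proof.
move=> sA sB; rewrite /grid_incidences -sum1_count big_mkcond big_allpairs /=.
rewrite (big_nth 0) big_mkord sA; apply: eq_bigr => x _.
by rewrite (big_nth 0) big_mkord sB; apply: eq_bigr => y _.
Qed.

(** Vertical and horizontal lines are discarded, which costs at most two slopes; hence [S.+2]. *)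
Lemma rich_family_of_lines {R : realType} {n : nat} (A B : seq R)
    (L : seq (line R)) (S K : nat) :
  size A = n -> size B = n -> uniq L ->
  (S.+2 <= num_slopes L)%N ->
  (forall l, l \in L -> (S <= num_parallel_others L l)%N) ->
  (forall l, l \in L -> (n <= K * grid_incidences l A B)%N) ->
  rich_family (fun i : 'I_n => nth 0 A i) (fun i : 'I_n => nth 0 B i) S S K.
Proof.
move=> sA sB uL slopes par rich.
pose bad : seq (option R) := [:: None; Some 0].
pose s := [seq x <- undup (map (@slope R) L) | x \notin bad].
have us : uniq s by rewrite filter_uniq // undup_uniq.
have sizes : (S <= size s)%N.
  have cbad : count (predC (mem bad)) (undup (map (@slope R) L)) = size s.
    by rewrite size_filter.
  have := slopes; rewrite /num_slopes -(count_predC (mem bad)) cbad.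
  suff : (count (mem bad) (undup (map (@slope R) L)) <= 2)%N by lia.
  rewrite -size_filter; apply: (@uniq_leq_size _ _ bad).
    by rewrite filter_uniq // undup_uniq.
  by move=> x; rewrite mem_filter => /andP[].
(* The default 0 is never taken, because [s] excludes [None]. *)
pose m (i : 'I_S) := odflt 0 (nth None s i).
have ms (i : 'I_S) : nth None s i \in s by apply: mem_nth; apply: leq_trans sizes.
have mE (i : 'I_S) : nth None s i = Some (m i).
  by rewrite /m; move: (ms i); case: nth => //; rewrite mem_filter.
pose c (i : 'I_S) := [seq l.2 | l <- L & slope l == Some (m i)].
have uc i : uniq (c i).
  rewrite map_inj_in_uniq ?filter_uniq // => -[x1 x2] [y1 y2].
  by rewrite !mem_filter /slope /= => /andP[/eqP -> _] /andP[/eqP -> _] ->.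
have sc i : (S <= size (c i))%N.
  have := ms i; rewrite mE mem_filter mem_undup => /andP[_ /mapP[l lL sl]].
  apply: leq_trans (par l lL) _; rewrite size_map size_filter sl.
  by apply: sub_count => l' /andP[].
exists m, (fun i t => nth 0 (c i) t); split.
- move=> i j mij; apply: (injective_nth None _ _ us sizes) => /=.
  by rewrite !mE mij.
- move=> i; apply: contraTneq (ms i) => m0.
  by rewrite mE m0 mem_filter !inE eqxx orbT.
- by move=> i; apply: (injective_nth 0 _ _ (uc i) (sc i)).
move=> i t; rewrite -grid_incidencesE //.
have : nth 0 (c i) t \in c i by apply: mem_nth; apply: leq_trans (sc i).
case/mapP=> -[x y]; rewrite mem_filter /slope /= => /andP[/eqP -> lL] ->.
exact: rich.
Qed.

Theorem theorem2 (R : realType) (eps : R) (heps : 0 < eps) :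
  exists delta : R, 0 < delta /\
  exists N : nat, forall n : nat, (N <= n)%N ->
  forall (A B : seq R) (L : seq (line R)),
    uniq A -> size A = n -> uniq B -> size B = n ->
    uniq L ->
    powR (n%:R) eps <= (num_slopes L)%:R ->
    (forall l, l \in L -> powR (n%:R) eps <= (num_parallel_others L l)%:R) ->
    exists2 l, l \in L & (grid_incidences l A B)%:R < powR (n%:R) (1 - delta).
Proof.
(* This choice gives [6 * g / e = 12 / W <= eps], where [e] is the exponent in the bound on [n] of
   [no_rich_family]. *)
pose W := (Num.Def.trunc (12 / eps)).+1.
have W_eps : 12 <= W%:R * eps.
  have /truncn_itv /andP[_ /ltW] : 0 <= 12 / eps by rewrite divr_ge0 // ltW.
  by rewrite ler_pdivrMr.
pose C := (4 ^ W)%N; pose g := (2 * W.+1 * C.+1)%N.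
pose e := (W * W.+1 * C.+1)%N.
have e0 : (0 < e)%N by rewrite !muln_gt0.
have eR0 : (0 : R) < e%:R by rewrite ltr0n.
have g_e : (6 * g)%:R * e%:R^-1 <= eps.
  rewrite ler_pdivrMr //.
  have -> : (6 * g)%:R = 12 * (W.+1 * C.+1)%:R :> R.
    by rewrite -natrM; congr _%:R; rewrite /g; clear; lia.
  rewrite /e -mulnA [X in eps * X]natrM mulrA (mulrC eps).
  by apply: ler_wpM2r W_eps; apply: ler0n.
exists (e%:R^-1); split; first by rewrite invr_gt0.
(* This forces [X >= 192 + 2 ^ (3 * g)]: the power of 2 pays for [Q <= 2 * X], and 192 covers the
   two extra slopes and [64 <= Q]. *)
exists ((192 + 2 ^ (3 * g)) ^ e)%N => n nN A B L uA sA uB sB uL slopes par.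
have [/hasP[l lL inc]|/hasPn rich] := boolP (has (fun l =>
  (grid_incidences l A B)%:R < powR (n%:R : R) (1 - e%:R^-1)) L); first by exists l.
exfalso.
have n0 : (0 < n)%N.
  by apply: leq_trans nN; rewrite expn_gt0 addn_gt0.
have nR0 : (0 : R) < n%:R by rewrite ltr0n.
pose X : R := powR n%:R e%:R^-1.
have X0 : 0 < X by rewrite powR_gt0.
have Xe : X ^+ e = n%:R.
  by rewrite -powR_mulrn ?ltW // -powRrM mulVf ?powRr1 ?gt_eqF // ltW.
have XN : (192 + 2 ^ (3 * g))%:R <= X.
  rewrite -(ler_pXn2r e0) ?nnegrE ?ler0n ?(ltW X0) //.
  by rewrite Xe -natrX ler_nat.
(* Rounding strictly above [X] gives both [n < Q ^ e] and [n / Q <= n / X], the richness of every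
   line. *)
pose Q := (Num.Def.trunc X).+1.
have /andP[QX XQ] : (Q.-1)%:R <= X < Q%:R by apply/truncn_itv/ltW.
have Q192 : (192 <= Q)%N.
  rewrite -(ler_nat R); apply: le_trans (ltW XQ); apply: le_trans XN.
  by rewrite ler_nat leq_addr.
have nQ : (n < Q ^ e)%N.
  rewrite -(ltr_nat R) -Xe natrX ltr_pXn2r // nnegrE ?ler0n //.
  exact: ltW.
have Q2X : Q%:R <= 2 * X.
  have : (192 + 2 ^ (3 * g))%:R = 192 + (2 ^ (3 * g))%:R :> R by rewrite natrD.
  have : (0 : R) <= (2 ^ (3 * g))%:R by [].
  have : Q%:R = Q.-1%:R + 1 :> R by rewrite natr1.
  by move: XN QX; clear; lra.
(* The chain is [Q ^ (3 * g) + 2 <= X * X ^ (3 * g) <= X ^ (6 * g) <= n ^ eps]. *)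
have Q_eps : (Q ^ (3 * g)).+2%:R <= powR n%:R eps.
  have n1 : (1 : R) <= n%:R by rewrite ler1n.
  apply: le_trans (ler_powR n1 g_e).
  rewrite mulrC powRrM -/X powR_mulrn ?(ltW X0) //.
  have Qpow : (Q ^ (3 * g))%:R <= (2 ^ (3 * g))%:R * X ^+ (3 * g).
    by rewrite !natrX -exprMn lerXn2r ?nnegrE // mulr_ge0 // ltW.
  have X1 : 1 <= X by apply: le_trans XN; rewrite ler1n.
  have XX : X <= X ^+ (3 * g) by rewrite -[leLHS]expr1 ler_weXn2l.
  have -> : (6 * g = 3 * g + 3 * g)%N by rewrite -mulnDl.
  rewrite exprD -addn2 natrD.
  move: XN; rewrite natrD => XN.
  move: (ler0n R (2 ^ (3 * g))) Qpow => p0 Qpow.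
  apply: le_trans (_ : X * X ^+ (3 * g) <= _); last first.
    by rewrite ler_pM2r // exprn_gt0.
  apply: le_trans (_ : (192 + (2 ^ (3 * g))%:R) * X ^+ (3 * g) <= _); last first.
    by rewrite ler_pM2r // exprn_gt0.
  by rewrite mulrDl; lra.
have injA : injective (fun i : 'I_n => nth 0 A i).
  by apply: injective_nth; rewrite ?sA.
have injB : injective (fun i : 'I_n => nth 0 B i).
  by apply: injective_nth; rewrite ?sB.
apply: (no_rich_family _ _ Q W injA injB n0 _ nQ); first exact: leq_trans Q192.
apply: (rich_family_of_lines _ _ L) => //.
- by rewrite -(ler_nat R); apply: le_trans Q_eps slopes.
- move=> l lL; apply: leq_trans (leqnSn _) _; apply: leq_trans (leqnSn _) _.
  by rewrite -(ler_nat R); apply: le_trans Q_eps (par l lL).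
move=> l /rich; rewrite -leNgt => inc.
rewrite -(ler_nat R) natrM -[leLHS](mulrVK (unitf_gt0 X0)).
have -> : n%:R / X = powR n%:R (1 - e%:R^-1).
  by rewrite powRB ?(gt_eqF nR0) ?implybT // powRr1 // ltW.
by rewrite mulrC; apply: ler_pM (ltW XQ) inc; [exact: ltW | exact: powR_ge0].
Qed.
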